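(* Let $r,g$ be non-negative integers, let $n\ge 1$, let $a=(a_1,\ldots,a_n)$ and $b=(b_1,\ldots,b_n)$ be two $n$-tuples of positive integers, and let $X$ be a non-empty subset of $\{r+1,\to\}$. Let $M_r(a,b,X)=\bigcap_{S\in\mathcal{N}_r(a,b,X)}S$. Then the problem $\mathrm{P}_r(a,b,X,g)$ has a solution if and only if the (possibly infinite) cardinality of $\mathbb{N}\setminus M_r(a,b,X)$ is greater than or equal to $g+r$.
   Context: $\mathbb{N}$ is the set of non-negative integers, $\{k,\to\}=\{m\in\mathbb{N}\mid m\ge k\}$ and $\{0,k,\to\}=\{0\}\cup\{k,\to\}$. A solution of the problem $\mathrm{P}_r(a,b,X,g)$ is a subset $C$ of $\{r+1,\to\}$ such that: (GP1) the cardinality of $C$ is equal to $g$; (GP2) if $x,y\in\{r+1,\to\}$ and $x+y\in C$, then $C\cap\{x,y\}\neq\emptyset$; (GP3) if $x\in C$ and $\frac{x-b_i}{a_i}\in\{r+1,\to\}$ for some $i\in\{1,\ldots,n\}$, then $\frac{x-b_i}{a_i}\in C$; (GP4) $X\cap C=\emptyset$. A numerical semigroup is a submonoid $S$ of $(\mathbb{N},+)$ with $\mathbb{N}\setminus S$ finite. For $s\in\mathbb{N}$, $as+b=(a_1s+b_1,\ldots,a_ns+b_n)$. $\mathcal{N}_r(a,b,X)$ is the set of all numerical semigroups $S\subseteq\{0,r+1,\to\}$ such that $X\subseteq S$ and $as+b\in S^n$ for all $s\in S\setminus\{0\}$. *)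

(* Defs.v *)
From mathcomp Require Import all_boot all_order all_algebra.
From mathcomp Require Import boolp classical_sets functions cardinality.

Set Implicit Arguments.
Unset Strict Implicit.
Unset Printing Implicit Defensive.

Local Open Scope nat_scope.
Local Open Scope classical_set_scope.
Local Open Scope card_scope.

Definition nat_from (k : nat) : set nat := [set m | k <= m].

Definition zero_nat_from (k : nat) : set nat := [set 0] `|` nat_from k.

Definition numerical_semigroup (S : set nat) : Prop :=
  [/\ S 0, (forall x y, S x -> S y -> S (x + y)) & finite_set (~` S)].

Definition set_power (n : nat) (S : set nat) : set (n.-tuple nat) :=
  [set t | forall i : 'I_n, S (tnth t i)].

Definition affine_tuple (n : nat) (a b : n.-tuple nat) (s : nat) :
    n.-tuple nat :=
  [tuple tnth a i * s + tnth b i | i < n].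

Definition semigroup_family (r n : nat) (a b : n.-tuple nat) (X : set nat) :
    set (set nat) :=
  [set S | [/\ numerical_semigroup S, S `<=` zero_nat_from r.+1, X `<=` S &
    forall s, (S `\ 0) s -> set_power S (affine_tuple a b s)]].

Definition family_meet (r n : nat) (a b : n.-tuple nat) (X : set nat) :
    set nat :=
  \bigcap_(S in semigroup_family r a b X) S.

(* The quotient (x - b_i) / a_i is computed in rat, so the fourth clause
   requires nothing when it is negative or not an integer. *)
Definition gap_solution (r n : nat) (a b : n.-tuple nat) (X : set nat)
    (g : nat) (C : set nat) : Prop :=
  [/\ C `<=` nat_from r.+1,
      C #= `I_g,
      (forall x y, nat_from r.+1 x -> nat_from r.+1 y -> C (x + y) ->
         C `&` [set x; y] !=set0),
      (forall (x : nat) (i : 'I_n) (y : nat), C x -> nat_from r.+1 y ->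
         ((x%:R - (tnth b i)%:R) / (tnth a i)%:R = y%:R :> rat)%R -> C y) &
      X `&` C = set0].

(* Main.v *)
Require Import Defs.
From mathcomp Require Import all_boot all_order all_algebra.
From mathcomp Require Import boolp classical_sets functions cardinality.
From mathcomp Require Import finmap.
From mathcomp Require Import zify.

Set Implicit Arguments.
Unset Strict Implicit.

Local Open Scope nat_scope.
Local Open Scope classical_set_scope.
Local Open Scope card_scope.

(** If [C] is a solution, then [{0, r+1, ->} \ C] belongs to the family, so [C]
    and [{1, ..., r}] consist of gaps of the meet [M].  Conversely, for every [k],
    the set of non-elements of [M] in the interval from [r+1] to [r+k] satisfies
    (GP2)-(GP4), because [M] is a submonoid stable under the affine maps, and
    sums and affine maps never produce a value smaller than their arguments.  The
    cardinality of this set starts at [0], grows by at most one with [k], and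
    reaches [g] as soon as [M] has at least [g + r] gaps. *)

Lemma card_eq_uniq (T : choiceType) (s : seq T) :
  uniq s -> [set` s] #= `I_(size s).
Proof.
move=> us; have -> : [set` s] = [set` seq_fset tt s].
  by apply/predeqP => x; rewrite /= -[x \in s](seq_fsetE tt).
by apply/card_eq_fsetP; rewrite size_seq_fset undup_id.
Qed.

(** Duplicate-free lists witness lower bounds on a possibly infinite cardinality, so finite and
    infinite complements of the meet are treated alike. *)
Lemma card_ge_uniqP (T : choiceType) (A : set T) (n : nat) :
  `I_n #<= A <->
  exists s : seq T, [/\ uniq s, size s = n & [set` s] `<=` A].
Proof.
split=> [/card_leP/injfunPex[f _ fI]|[s [us <- sA]]]; last first.
  apply: card_le_trans (subset_card_le sA).
  by have /card_eqPle[] := card_eq_uniq us.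
(* The injection [f] starts from the subtype of [I_n]; moved to ordinals, its image can be listed as
   [codom h]. *)
have mI (i : 'I_n) : val i \in `I_n by apply: mem_set; exact: ltn_ord.
pose h (i : 'I_n) : T := val (f (SigSub (mI i))).
have h_inj : injective h.
  move=> i j /val_inj/fI; rewrite !in_setT => /(_ isT isT) [].
  exact: val_inj.
exists (codom h); split; first exact/injectiveP.
- by rewrite size_codom card_ord.
- by move=> _ /= /codomP[i ->]; rewrite /h; apply/set_mem/valP.
Qed.

(** A discrete intermediate value property: at the first crossing, [d K < g <= d K.+1 <= (d K).+1]
    forces equality. *)
Lemma reach_by_unit_steps (d : nat -> nat) (g K : nat) :
  d 0 = 0 -> (forall k, d k.+1 <= (d k).+1) -> g <= d K -> exists k, d k = g.
Proof.
move=> d0 dS; elim: K => [|K IH] gd; first by exists 0; lia.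
have [/IH//|dg] := leqP g (d K).
by exists K.+1; have := dS K; lia.
Qed.

Lemma affine_quotient (x b a y : nat) : 0 < a ->
  ((x%:R - b%:R) / a%:R = y%:R :> rat)%R <-> x = a * y + b.
Proof.
move=> a0; have an0 : (a%:R != 0 :> rat)%R by rewrite Num.Theory.pnatr_eq0; lia.
split=> [/(canRL (GRing.divfK an0)) /eqP|->].
  rewrite GRing.subr_eq -GRing.natrM -GRing.natrD Num.Theory.eqr_nat => /eqP.
  by rewrite mulnC.
rewrite GRing.natrD GRing.addrK GRing.natrM.
by rewrite [LHS]GRing.mulrAC GRing.divff ?GRing.mul1r.
Qed.

Lemma gap_solution0 (r n : nat) (a b : n.-tuple nat) (X : set nat) :
  gap_solution r a b X 0 set0.
Proof. by split=> //; [rewrite II0 | rewrite setI0]. Qed.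

(** Closure under addition and under the affine maps are the contrapositives of (GP2) and (GP3);
    (GP4) gives the inclusion of [X], and (GP1) cofiniteness. *)
Lemma gap_solution_family (r g n : nat) (a b : n.-tuple nat) (X C : set nat) :
  (forall i, 0 < tnth a i) -> X `<=` nat_from r.+1 ->
  gap_solution r a b X g C ->
  semigroup_family r a b X (zero_nat_from r.+1 `\` C).
Proof.
move=> ha hX [Cr Cg C2 C3 C4].
have C0 : ~ C 0 by move/Cr.
split.
- split.
  + by split; [left|].
  + move=> x y [[->|rx] Cx]; first by rewrite add0n.
    move=> [[->|ry] Cy]; first by rewrite addn0; split; [right|].
    split; first by right; rewrite /nat_from /= in rx ry *; lia.
    by move=> /(C2 _ _ rx ry) [z [Cz [] zE]]; rewrite -zE in Cx Cy.
  + have fC : finite_set C by exists g.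
    apply: (@sub_finite_set _ _ (`I_r.+1 `|` C)); last by rewrite finite_setU.
    move=> x /= nx; have [xr|rx] := ltnP x r.+1; [by left|right].
    by apply: contrapT => Cx; apply: nx; split=> //; right.
- by move=> x [].
- move=> x Xx; split; first by right; exact: hX.
  by move=> Cx; have : (X `&` C) x by []; rewrite C4.
- move=> s [[[s0|rs] Cs] sn0] i; first by case: sn0.
  rewrite tnth_mktuple /nat_from /= in rs *; have ai := ha i; split.
    by right; rewrite /nat_from /=; nia.
  by move=> /C3 /(_ rs) /(_ (iffRL (affine_quotient _ _ _ ai) erefl)).
Qed.

Section FamilyMeet.

Context {r n : nat} {a b : n.-tuple nat} {X : set nat}.
Local Notation M := (family_meet r a b X).

Lemma family_meet0 : M 0.
Proof. by move=> S [[]]. Qed.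

Lemma family_meetD x y : M x -> M y -> M (x + y).
Proof.
move=> Mx My S FS; case: (FS) => [[_ SD _] _ _ _].
by apply: SD; [exact: Mx|exact: My].
Qed.

Lemma family_meet_affine s (i : 'I_n) :
  M s -> s != 0 -> M (tnth a i * s + tnth b i).
Proof.
move=> Ms /eqP s0 S FS; case: (FS) => _ _ _ /(_ s) SA.
by have := SA (conj (Ms _ FS) s0) i; rewrite tnth_mktuple.
Qed.

Lemma family_meet_sup : X `<=` M.
Proof. by move=> x Xx S [_ _ XS _]; exact: XS. Qed.

(** A list rather than a set, so that its size is a number that can be followed as [k] grows. *)
Definition meet_gaps (k : nat) : seq nat :=
  [seq x <- iota r.+1 k | `[< ~ M x >]].

Lemma meet_gapsP k x :
  [set` meet_gaps k] x <-> [/\ r < x, x < r.+1 + k & ~ M x].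
Proof.
rewrite /= mem_filter mem_iota; split; first by case/and3P=> /asboolP.
by case=> rx xk Mx; apply/and3P; split=> //; apply/asboolP.
Qed.

Lemma meet_gaps_solution k : (forall i, 0 < tnth a i) ->
  gap_solution r a b X (size (meet_gaps k)) [set` meet_gaps k].
Proof.
move=> ha; split.
- by move=> x /meet_gapsP[].
- by apply: card_eq_uniq; rewrite filter_uniq ?iota_uniq.
- move=> x y rx ry /meet_gapsP[_ xyk Mxy]; rewrite /nat_from /= in rx ry.
  have [Mx|nMx] := pselect (M x); last first.
    by exists x; split; [apply/meet_gapsP; split=> //; lia | left].
  have [My|nMy] := pselect (M y); first by case: Mxy; exact: family_meetD.
  by exists y; split; [apply/meet_gapsP; split=> //; lia | right].
- move=> x i y /meet_gapsP[_ xk Mx] ry; rewrite /nat_from /= in ry.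
  have ai := ha i.
  move=> /(affine_quotient _ _ _ ai) xE; apply/meet_gapsP; split=> //.
    (* Since [tnth a i] is positive, [y <= tnth a i * y + tnth b i = x], so [y] stays below the
       cut-off. *)
    by nia.
  move=> My; apply: Mx; rewrite xE; apply: family_meet_affine => //.
  by rewrite -lt0n; lia.
- apply/seteqP; split=> // x [/family_meet_sup Mx /meet_gapsP[_ _]]; exact.
Qed.

Lemma size_meet_gapsS k :
  size (meet_gaps k.+1) <= (size (meet_gaps k)).+1.
Proof.
rewrite /meet_gaps -[k.+1]addn1 iotaD filter_cat size_cat /=.
by case: ifP => _ /=; lia.
Qed.

(** A gap is nonzero, so it lies in [iota 1 r] or above [r]; taking [k] to be the maximum of [t]
    captures all the latter. *)
Lemma size_meet_gaps_ge (t : seq nat) : uniq t -> [set` t] `<=` ~` M ->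
  exists k, size t <= r + size (meet_gaps k).
Proof.
move=> ut tM; exists (\max_(x <- t) x).
rewrite -[X in X + _](size_iota 1) -size_cat; apply: uniq_leq_size => // x xt.
have Mx : ~ M x by exact: tM.
have x0 : x != 0 by apply/eqP => x0; apply: Mx; rewrite x0; exact: family_meet0.
rewrite mem_cat mem_iota; apply/orP.
have [xr|rx] := leqP x r; [left; lia|right; apply/meet_gapsP; split=> //].
have xle : x <= \max_(y <- t) y by exact: leq_bigmax_seq.
by lia.
Qed.

End FamilyMeet.

Unset Implicit Arguments.

Theorem proposition4p1 (r g n : nat) (a b : n.-tuple nat) (X : set nat)
    (hn : 1 <= n)
    (ha : forall i : 'I_n, 0 < tnth a i)
    (hb : forall i : 'I_n, 0 < tnth b i)
    (hX : X `<=` nat_from r.+1)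
    (hX0 : X !=set0) :
  (exists C : set nat, gap_solution r a b X g C) <->
  `I_(g + r) #<= ~` (family_meet r a b X).
Proof.
split.
  move=> [C CP]; case: (CP) => Cr Cg _ _ _.
  have /card_eqPle[_ /card_ge_uniqP[s [us ss sC]]] := Cg.
  (* The [g] elements of [C] exceed [r], hence are distinct from the [r] further gaps
     [1, ..., r]. *)
  apply/card_ge_uniqP; exists (s ++ iota 1 r); split.
  - rewrite cat_uniq us iota_uniq andbT; apply/hasPn => x.
    rewrite mem_iota => xr; apply/negP => /sC /Cr; rewrite /nat_from /=; lia.
  - by rewrite size_cat size_iota ss.
  - move=> x /=; rewrite mem_cat mem_iota => /orP[/sC Cx|xr] Mx.
      by case: (Mx _ (gap_solution_family ha hX CP)).
    (* The empty solution, with [g = 0], puts [zero_nat_from r.+1] itself in the family, which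
       excludes [1, ..., r] from the meet. *)
    have [[x0|]] := Mx _ (gap_solution_family ha hX
      (gap_solution0 r a b X)); first by rewrite x0 in xr.
    by rewrite /nat_from /= => rx; lia.
move=> /card_ge_uniqP[t [ut st tM]].
have [K tK] := size_meet_gaps_ge ut tM.
have [||k <-] := @reach_by_unit_steps
    (fun k => size (@meet_gaps r n a b X k)) g K _ size_meet_gapsS.
- by [].
- by move: tK; rewrite st addnC leq_add2l.
- by exists [set` @meet_gaps r n a b X k]; exact: meet_gaps_solution.
Qed.
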